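(* Let $K$ be a field of characteristic zero, $l\in\mathbb{N}$, and let $(\rho,\sigma)\in\mathbb{Z}^2$ with $\gcd(\rho,\sigma)=1$, $\rho>0$ and $\rho+\sigma<0$. Let $R,G\in L^{(l)}$ be $(\rho,\sigma)$-homogeneous elements such that $R$ is not a monomial and $[G,R]=R^i$, where $i\in\mathbb{N}$. Put $u=v_{\rho,\sigma}(R)$, $v=v_{\rho,\sigma}(G)$, and assume that there exists $\ell>0$ such that $\ell u+\rho+\sigma>0$ (or, equivalently, that $u>0$); fix such an $\ell$. Write $R=x^{u/\rho}r(z)$ and $G=x^{v/\rho}g(z)$, where $z=x^{-\sigma/\rho}y$ and $r,g$ are univariate polynomials. Write $\operatorname{st}_{\rho,\sigma}(R)=\left(\frac{\upsilon_2}{l},\nu_2\right)$ and $\operatorname{en}_{\rho,\sigma}(R)-\operatorname{st}_{\rho,\sigma}(R)=\left(\frac{\upsilon_1}{l},\nu_1\right)$, and set $$N_1=\frac{\nu_1\gcd(\rho,l)}{\rho}\;(=\gcd(\upsilon_1,\nu_1)),\qquad N_2=\gcd(\upsilon_2,\nu_2).$$ Then one of the following three cases occurs: (1) $\rho\mid l$ and $r=\xi h^j$ for some $\xi\in K^\times$, some linear polynomial $h\ne z$ and some $j\in\mathbb{N}$. (2) There exist $\vartheta,t'\in\mathbb{N}$ such that $\vartheta\le N_1$, $0<t'<\ell\vartheta$ and $(\rho,\sigma)=-\operatorname{dir}\bigl(t'\operatorname{st}_{\rho,\sigma}(R)+\vartheta(1,1)\bigr)$. In this case there exists a linear factor of $r(z)$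 with multiplicity $\vartheta$. (3) There exist $\vartheta,t'\in\mathbb{N}$ such that $\vartheta\mid N_2$, $0<t'<\ell\vartheta$ and $(\rho,\sigma)=-\operatorname{dir}\bigl(t'\operatorname{st}_{\rho,\sigma}(R)+\vartheta(1,1)\bigr)$. In this case $\nu_2>0$. Moreover, if $l=1$ and case (1) occurs, then $v_{1,-2}(\operatorname{en}_{\rho,\sigma}(R))>0$.
   Context: $\mathbb{N}=\{1,2,\dots\}$. $L^{(l)}=K[x^{\pm1/l},y]$ and $[P,Q]=\partial_xP\,\partial_yQ-\partial_xQ\,\partial_yP$. The support of $P=\sum a_{i/l,j}x^{i/l}y^j$ is the set of $(i/l,j)$ with $a_{i/l,j}\ne0$. For a point, $v_{\rho,\sigma}(a,b)=\rho a+\sigma b$; for nonzero $P\in L^{(l)}$, $v_{\rho,\sigma}(P)$ is the maximum of $v_{\rho,\sigma}$ on the support; $P$ is $(\rho,\sigma)$-homogeneous if $v_{\rho,\sigma}$ is constant on the support. For a nonzero $(\rho,\sigma)$-homogeneous $R$ (with $\rho>0$), $\operatorname{st}_{\rho,\sigma}(R)$ (resp. $\operatorname{en}_{\rho,\sigma}(R)$) is the support point with smallest (resp. largest) second coordinate. For $(a,b)\in\frac1l\mathbb{Z}\times\mathbb{Z}$ not an integer multiple of $(1,1)$, $\operatorname{dir}(a,b)$ is the unique $(\rho',\sigma')\in\mathbb{Z}^2$ with $\gcd(\rho',\sigma')=1$, $\rho'+\sigma'>0$ and $\rho'a+\sigma'b=0$.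
   Formalization: In case (2) the linear factor of r(z) of multiplicity ϑ is taken over a finite extension of K, since over K it may not exist (K=Q, R=x+x^5y^2, G=-x^2y-x^6y^3/3, r=z^2+1); R≠0 is explicit and ℓ is rational. *)

(* Defs.v *)
From HB Require Import structures.
From mathcomp Require Import all_boot all_order all_algebra all_field finmap.
From mathcomp.multinomials Require Import monalg.

Set Implicit Arguments.
Unset Strict Implicit.
Unset Printing Implicit Defensive.

Import Order.TTheory GRing.Theory Num.Theory.
Local Open Scope ring_scope.

(* K[x^Q, y], the union of the rings L^(l) = K[x^(+-1/l), y] over all l >= 1:
   the index (a, j) stands for the monomial x^a y^j.  monalg only provides the
   product when the monomials form a monoid without nontrivial units, which
   fails for rational exponents, so the ring structure is built below. *)
Definition puiseux (K : fieldType) : Type := {malg K[(rat * nat)%type]}.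

HB.instance Definition _ (K : fieldType) := GRing.Lmodule.on (puiseux K).

Section PuiseuxRing.
Variable K : fieldType.
Implicit Types (P Q : puiseux K) (m : rat * nat).

Definition madd m1 m2 : rat * nat := (m1.1 + m2.1, (m1.2 + m2.2)%N).

Definition pz_one : puiseux K := << 1 *g (0, 0%N) >>.

Definition pz_mul P Q : puiseux K :=
  \sum_(m1 <- msupp P) \sum_(m2 <- msupp Q) << P@_m1 * Q@_m2 *g madd m1 m2 >>.

Fact maddA : associative madd.
Proof. by move=> a b c; rewrite /madd /= addrA addnA. Qed.

Fact maddC : commutative madd.
Proof. by move=> a b; rewrite /madd addrC addnC. Qed.

Fact madd0m : left_id (0, 0%N) madd.
Proof. by case=> a b; rewrite /madd /= add0r. Qed.

Fact pz_mulw (d1 d2 : {fset rat * nat}) P Q :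
  (msupp P `<=` d1)%fset -> (msupp Q `<=` d2)%fset ->
  pz_mul P Q =
  \sum_(m1 <- d1) \sum_(m2 <- d2) << P@_m1 * Q@_m2 *g madd m1 m2 >>.
Proof.
move=> le1 le2; rewrite /pz_mul (big_fset_incl _ le1) /=.
  apply/eq_bigr=> m1 _; apply/big_fset_incl => // m _ /mcoeff_outdom ->.
  by rewrite mulr0 monalgU0.
move=> m _ /mcoeff_outdom Pm; rewrite big1 // => m' _.
by rewrite Pm mul0r monalgU0.
Qed.

Fact pz_mulC : commutative pz_mul.
Proof.
move=> P Q; rewrite /pz_mul exchange_big /=.
by apply: eq_bigr => a _; apply: eq_bigr => b _; rewrite mulrC maddC.
Qed.

Fact pz_mul0 : left_zero 0 pz_mul.
Proof. by move=> P; rewrite /pz_mul msupp0 big_seq_fset0. Qed.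

Fact pz_mulDl : left_distributive pz_mul +%R.
Proof.
move=> P1 P2 Q.
rewrite [in RHS](pz_mulw (fsubsetUl _ (msupp P2)) (fsubset_refl _)).
rewrite [in RHS](pz_mulw (fsubsetUr (msupp P1) _) (fsubset_refl _)).
rewrite (pz_mulw (msuppD_le _ _) (fsubset_refl _)).
rewrite -big_split /=; apply/eq_bigr=> k1 _.
rewrite -big_split /=; apply/eq_bigr=> k2 _.
by rewrite mcoeffD mulrDl monalgUD.
Qed.

Fact pz_mulDr : right_distributive pz_mul +%R.
Proof. by move=> P Q1 Q2; rewrite !(pz_mulC P) pz_mulDl. Qed.

Fact pz_mulUU (c1 c2 : K) m1 m2 :
  pz_mul << c1 *g m1 >> << c2 *g m2 >> = << c1 * c2 *g madd m1 m2 >>.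
Proof.
by rewrite (pz_mulw msuppU_le msuppU_le) !big_seq_fset1 !mcoeffUU.
Qed.

Fact pz_mulUl (c : K) m P :
  pz_mul << c *g m >> P = \sum_(k <- msupp P) << c * P@_k *g madd m k >>.
Proof.
rewrite (pz_mulw msuppU_le (fsubset_refl _)) big_seq_fset1.
by apply/eq_bigr => k _; rewrite mcoeffUU.
Qed.

Fact pz_mul1 : left_id pz_one pz_mul.
Proof.
move=> P; rewrite pz_mulUl [RHS]monalgE.
by apply/eq_bigr=> k _; rewrite mul1r madd0m.
Qed.

Fact pz_mulEl P Q :
  pz_mul P Q = \sum_(m <- msupp P) pz_mul << P@_m *g m >> Q.
Proof. by apply/eq_bigr=> k _; rewrite pz_mulUl. Qed.

Fact pz_mulEr P Q :
  pz_mul P Q = \sum_(m <- msupp Q) pz_mul P << Q@_m *g m >>.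
Proof. by rewrite pz_mulC pz_mulEl; apply: eq_bigr => k _; rewrite pz_mulC. Qed.

Fact pz_mulA : associative pz_mul.
Proof.
have mul0 P : pz_mul P 0 = 0 by rewrite pz_mulC pz_mul0.
move=> P1 P2 P3.
rewrite [RHS](big_morph (pz_mul^~ _) (fun _ _ => pz_mulDl _ _ _) (pz_mul0 _)).
rewrite pz_mulEl; apply/eq_bigr=> k1 _.
rewrite [LHS](big_morph (pz_mul _) (fun _ _ => pz_mulDr _ _ _) (mul0 _)).
rewrite [RHS](big_morph (pz_mul^~ _) (fun _ _ => pz_mulDl _ _ _) (pz_mul0 _)).
apply/eq_bigr=> k2 _.
rewrite [LHS](big_morph (pz_mul _) (fun _ _ => pz_mulDr _ _ _) (mul0 _)).
by rewrite pz_mulEr; apply/eq_bigr=> k3 _; rewrite !pz_mulUU mulrA maddA.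
Qed.

Fact pz_one_neq0 : pz_one != 0.
Proof. by rewrite monalgU_eq0 oner_eq0. Qed.

HB.instance Definition _ := GRing.Zmodule_isComNzRing.Build (puiseux K)
  pz_mulA pz_mulC pz_mul1 pz_mulDl pz_one_neq0.

Fact pz_scaleAl (c : K) P Q : c *: (P * Q) = (c *: P) * Q.
Proof.
have scE R : c *: R = pz_mul << c *g (0, 0%N) >> R.
  by rewrite pz_mulUl; apply: eq_bigr => k _; rewrite madd0m.
rewrite !scE; exact: pz_mulA.
Qed.

HB.instance Definition _ :=
  GRing.Lmodule_isLalgebra.Build K (puiseux K) pz_scaleAl.
HB.instance Definition _ := GRing.Lalgebra_isComAlgebra.Build K (puiseux K).

Definition xy (a : rat) (j : nat) : puiseux K := << 1 *g (a, j) >>.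

Definition in_L (l : nat) P : Prop :=
  {in msupp P, forall m, m.1 * l%:R \is a Num.int}.

Definition d_x P : puiseux K :=
  \sum_(m <- msupp P) << ratr m.1 * P@_m *g (m.1 - 1, m.2) >>.

(* For m.2 = 0 the truncated exponent is harmless: the coefficient is 0. *)
Definition d_y P : puiseux K :=
  \sum_(m <- msupp P) << m.2%:R * P@_m *g (m.1, m.2.-1) >>.

Definition bracket P Q : puiseux K := d_x P * d_y Q - d_x Q * d_y P.

Definition supp P : seq (rat * int) := [seq (m.1, m.2%:Z) | m <- msupp P].

Definition is_monomial P : bool := size (supp P) == 1%N.

End PuiseuxRing.

Definition val_pt (rho sigma : int) (p : rat * int) : rat :=
  rho%:~R * p.1 + sigma%:~R * p.2%:~R.

Section Homogeneous.
Variable K : fieldType.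
Implicit Type P : puiseux K.

(* Only meaningful for P != 0; the value at P = 0 is 0. *)
Definition vdeg (rho sigma : int) P : rat :=
  let s := [seq val_pt rho sigma p | p <- supp P] in
  \big[Num.max/head 0 s]_(w <- s) w.

Definition homogeneous (rho sigma : int) P : Prop :=
  {in supp P &, forall p q, val_pt rho sigma p = val_pt rho sigma q}.

(* The support sorted by second coordinate: for a nonzero
   (rho, sigma)-homogeneous P with rho > 0 the second coordinates are pairwise
   distinct, and the first and last points are st(P) and en(P). *)
Definition supp_by_y P : seq (rat * int) :=
  sort (fun p q : rat * int => p.2 <= q.2) (supp P).

Definition st P : rat * int := head (0, 0) (supp_by_y P).
Definition en P : rat * int := last (0, 0) (supp_by_y P).

(* P = x^(u/rho) p(z) with z = x^(-sigma/rho) y *)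
Definition z_expansion (rho sigma : int) (u : rat) (p : {poly K}) : puiseux K :=
  xy K (u / rho%:~R) 0 * horner_alg (xy K (- sigma%:~R / rho%:~R) 1) p.

End Homogeneous.

(* d = dir(w); the clauses determine d uniquely. *)
Definition is_dir (w : rat * int) (d : int * int) : Prop :=
  [/\ forall n : int, w <> (n%:~R, n),
      coprimez d.1 d.2, 0 < d.1 + d.2 & val_pt d.1 d.2 w = 0].

(* Linear factors are taken over an algebraic closure of K, i.e. over some
   finite extension L of K; if K is algebraically closed they lie in K[z].
   Over K itself they need not exist: for K = Q, (rho, sigma) = (1, -2),
   R = x + x^5 y^2 and G = - x^2 y - x^6 y^3 / 3 one has [G, R] = R^2, while
   r = z^2 + 1 is irreducible over Q. *)
Definition has_linear_factor_of_mult (K : fieldType) (r : {poly K}) (m : nat) :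
  Prop :=
  exists (L : fieldExtType K) (a : L), mup a (map_poly (in_alg L) r) = m.

Definition linear_power_case (K : fieldType) (l : nat) (rho : int)
    (r : {poly K}) : Prop :=
  (rho %| l%:Z)%Z /\
  exists (xi : K) (h : {poly K}) (j : nat),
    [/\ xi != 0, size h = 2%N, h != 'X, (0 < j)%N & r = xi *: h ^+ j].

(* Main.v *)
Require Import Defs.
From Stdlib Require Import Classical.
From HB Require Import structures.
From mathcomp Require Import all_boot all_order all_algebra all_field finmap.
From mathcomp Require Import ring lra zify.
From mathcomp.multinomials Require Import monalg.
Set Implicit Arguments.
Unset Strict Implicit.
Unset Printing Implicit Defensive.

Import Order.TTheory GRing.Theory Num.Theory.
Local Open Scope ring_scope.

(** Writing [R = x^(u/rho) r(z)] and [G = x^(v/rho) g(z)], the equation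
    [[G, R] = R^i] becomes [v g r' - u r g' = rho r^i] together with
    [v = (i-1) u + rho + sigma].  At a root of [r] of multiplicity [m], let [n]
    be the multiplicity of that root in [g].  Comparing orders of vanishing,
    either [v m = u n] or [n = (i-1) m + 1].  In the first case
    [t = (i-1) m - n] satisfies [t u = -(rho + sigma) m]; a nonzero root gives
    case (2) with [(theta, t') = (m, t)], and the root [0] gives case (3) with
    [(m, t) / gcd (m, t)], where [theta] divides [upsilon_2] because the lowest
    support point of [G] lies in the lattice.  If every root is of the second
    kind, then [deg g] is at least [(i-1) deg r] plus the number of roots, while
    comparison of degrees gives [deg g <= (i-1) deg r + 1]; so [r] has a single
    root, which is case (1). *)

(** * Rational scalars in a field of characteristic zero *)

Section CharZero.
Variables (F : fieldType) (charF : [pchar F] =i pred0).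

Lemma natr_eq0_pchar0 n : (n%:R == 0 :> F) = (n == 0)%N.
Proof. by move/pcharf0P: charF => ->. Qed.

Lemma intr_eq0_pchar0 z : (z%:~R == 0 :> F) = (z == 0).
Proof. by case: z => n; rewrite ?NegzE ?mulrNz ?oppr_eq0 -pmulrn natr_eq0_pchar0. Qed.

(** [ratr] is computed from the reduced fraction. In characteristic zero no nonzero denominator
    vanishes in [F], so any other fraction of the same value has the same image, by
    cross-multiplication in the integers. *)
Lemma ratr_pchar0 p q : q != 0 -> ratr (p%:~R / q%:~R) = p%:~R / q%:~R :> F.
Proof.
move=> q0; set x := _ / _; rewrite /ratr.
have dx0 : (denq x)%:~R != 0 :> F by rewrite intr_eq0_pchar0 denq_neq0.
have q0F : q%:~R != 0 :> F by rewrite intr_eq0_pchar0.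
apply/eqP; rewrite eqr_div // -!intrM.
have -> // : numq x * q = p * denq x.
apply: (@intr_inj rat); rewrite !intrM.
have q0Q : q%:~R != 0 :> rat by rewrite intr_eq0.
have dx0Q : (denq x)%:~R != 0 :> rat by rewrite intr_eq0 denq_neq0.
apply/eqP; rewrite -eqr_div //; exact/eqP/divq_num_den.
Qed.

Lemma ratr_int_pchar0 z : ratr z%:~R = z%:~R :> F.
Proof. by rewrite -[_%:~R]divr1 (@ratr_pchar0 z 1) // divr1. Qed.

Lemma ratr_nat_pchar0 n : ratr n%:R = n%:R :> F.
Proof. by rewrite (ratr_int_pchar0 n). Qed.

Lemma ratrM_pchar0 x y : ratr (x * y) = ratr x * ratr y :> F.
Proof.
rewrite -[x]divq_num_den -[y]divq_num_den mulf_div -!intrM !ratr_pchar0 ?mulf_neq0 ?denq_neq0 //.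
by rewrite mulf_div !intrM.
Qed.

Lemma ratrD_pchar0 x y : ratr (x + y) = ratr x + ratr y :> F.
Proof.
have d0 (z : rat) : (denq z)%:~R != 0 :> rat by rewrite intr_eq0 denq_neq0.
have d0F (z : rat) : (denq z)%:~R != 0 :> F by rewrite intr_eq0_pchar0 denq_neq0.
rewrite -[x]divq_num_den -[y]divq_num_den addf_div // -!intrM -intrD.
by rewrite !ratr_pchar0 ?mulf_neq0 ?denq_neq0 // addf_div // !intrM intrD !intrM.
Qed.

Lemma ratr_eq0_pchar0 x : (ratr x == 0 :> F) = (x == 0).
Proof.
rewrite -[x in LHS]divq_num_den ratr_pchar0 ?denq_neq0 // mulf_eq0 invr_eq0.
by rewrite !intr_eq0_pchar0 numq_eq0 (negPf (denq_neq0 x)) orbF.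
Qed.

Lemma ratr_inj_pchar0 : injective (ratr : rat -> F).
Proof.
move=> x y Exy; have : ratr (x - y) + ratr y = ratr y :> F.
  by rewrite -ratrD_pchar0 subrK.
move/eqP; rewrite -subr_eq0 addrK ratr_eq0_pchar0 subr_eq0.
exact: eqP.
Qed.

End CharZero.

(** * Weighted expansions and the Jacobian bracket *)

Lemma mulrACAB (A : comPzRingType) (x y a b c d : A) :
  x * y * (a * b - c * d) = (x * a) * (y * b) - (x * c) * (y * d).
Proof. by rewrite mulrBr !(mulrACA x y). Qed.

(* [x^w p(x^c y)]; locked, since conversion would otherwise unfold the products of the
   Puiseux ring. *)
HB.lock Definition expand (K : fieldType) (w c : rat) (p : {poly K}) : puiseux K :=
  xy K w 0 * horner_alg (xy K c 1) p.

Section Puiseux.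
Variable K : fieldType.
Implicit Types (P Q : puiseux K) (p q : {poly K}) (w c : rat).

Lemma xyM a j b k : xy K a j * xy K b k = xy K (a + b) (j + k).
Proof. by rewrite /xy [LHS]pz_mulUU mulr1. Qed.

Lemma xyX a j n : xy K a j ^+ n = xy K (a *+ n) (j * n).
Proof.
elim: n => [|n IHn]; first by rewrite expr0 mulr0n muln0.
by rewrite exprS IHn xyM mulrS mulnS.
Qed.

Lemma xyE a j m : (xy K a j)@_m = ((a, j) == m)%:R.
Proof. by rewrite /xy mcoeffU -mulr_natr mul1r. Qed.

Lemma z_expansionE (rho sigma : int) (u : rat) p :
  z_expansion rho sigma u p = expand (u / rho%:~R) (- sigma%:~R / rho%:~R) p.
Proof. by rewrite expand.unlock. Qed.

Lemma expandE w c p :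
  expand w c p = \sum_(k < size p) p`_k *: xy K (w + c * k%:R) k.
Proof.
rewrite expand.unlock /horner_alg /= /horner_morph /= horner_coef size_map_poly mulr_sumr.
apply: eq_bigr => k _; rewrite coef_map /= xyX mul1n -scalerAl mul1r -scalerAr xyM add0n.
by rewrite mulr_natr.
Qed.

Lemma expand_coef w c p m :
  (expand w c p)@_m = if m.1 == w + c * m.2%:R then p`_(m.2) else 0.
Proof.
rewrite expandE raddf_sum /=; case: m => a k /=.
have E j : (p`_j *: xy K (w + c * j%:R) j)@_(a, k) =
    if (k == j) && (a == w + c * k%:R) then p`_k else 0.
  rewrite mcoeffZ xyE xpair_eqE.
  have [<-|nkj] := eqVneq k j; last by rewrite andbF mulr0.
  by rewrite andbT eq_sym; case: eqP => _; rewrite ?mulr1 ?mulr0.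
under eq_bigr do rewrite E.
have [_|_] := eqVneq a; last by apply: big1 => j _; rewrite andbF.
under eq_bigr do rewrite andbT eq_sym.
rewrite -big_mkcond /=; have [lt|ge] := ltnP k (size p).
  by rewrite (big_pred1 (Ordinal lt)).
rewrite nth_default // big_pred0 // => j; apply/negP => /eqP jk.
by have := ltn_ord j; rewrite jk ltnNge ge.
Qed.

Lemma expandM w1 w2 c p q : expand w1 c p * expand w2 c q = expand (w1 + w2) c (p * q).
Proof. by rewrite expand.unlock mulrACA xyM rmorphM. Qed.

Lemma expandX w c p n : expand w c p ^+ n = expand (w *+ n) c (p ^+ n).
Proof. by rewrite expand.unlock exprMn xyX mul0n rmorphXn. Qed.

Lemma expandB w c p q : expand w c (p - q) = expand w c p - expand w c q.
Proof. by rewrite expand.unlock rmorphB mulrBr. Qed.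

(** The leading coefficient of [q] is nonzero, so its monomial also occurs on the left; this forces
    equal offsets, and then coefficients compare one by one. *)
Lemma expand_inj w1 w2 c p q : q != 0 ->
  expand w1 c p = expand w2 c q -> w1 = w2 /\ p = q.
Proof.
move=> q0 E.
have C k : expand w1 c p = expand w2 c q -> (expand w1 c p)@_(w2 + c * k%:R, k) = q`_k.
  by move=> ->; rewrite expand_coef eqxx.
have w12 : w1 = w2.
  have := C (size q).-1 E; rewrite expand_coef /=.
  case: eqP => [/addIr -> //|_] /esym/eqP.
  by rewrite -lead_coefE lead_coef_eq0 (negPf q0).
split=> //; apply/polyP => k; have := C k E.
by rewrite w12 expand_coef eqxx.
Qed.

(** The Euler operators [x d/dx] and [y d/dy] have this diagonal form, which avoids the exponent
    shifts of [d_x] and [d_y]. *)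
Definition coef_scale (f : rat * nat -> K) P : puiseux K :=
  \sum_(m <- msupp P) << f m * P@_m *g m >>.

Lemma coef_scaleE f P m : (coef_scale f P)@_m = f m * P@_m.
Proof.
rewrite /coef_scale raddf_sum /=.
under eq_bigr do rewrite mcoeffU.
have [mP|mP] := boolP (m \in msupp P).
  rewrite (bigD1_seq m) //= eqxx mulr1n big1 ?addr0 // => m' /negPf ->.
  by rewrite mulr0n.
rewrite (mcoeff_outdom mP) mulr0 big1_seq // => m' /andP [_ m'P].
by case: eqP mP => [<-|_]; rewrite ?m'P ?mulr0n.
Qed.

Lemma x_dx P : xy K 1 0 * d_x P = coef_scale (fun m => ratr m.1) P.
Proof.
rewrite /d_x mulr_sumr; apply: eq_bigr => m _.
rewrite /xy [LHS]pz_mulUU mul1r /madd /= add0n addrC subrK.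
by case: m.
Qed.

Lemma y_dy P : xy K 0 1 * d_y P = coef_scale (fun m => m.2%:R) P.
Proof.
rewrite /d_y mulr_sumr; apply: eq_bigr => -[a k] _.
rewrite /xy [LHS]pz_mulUU mul1r /madd /= add0r.
by case: k => [|k] //=; rewrite mul0r !monalgU0.
Qed.

Hypothesis charK : [pchar K] =i pred0.

Lemma x_dx_expand w c p :
  xy K 1 0 * d_x (expand w c p) =
  expand w c ((ratr w : K) *: p + (ratr c : K) *: ('X * p^`())).
Proof.
rewrite x_dx; apply/malgP => -[a k]; rewrite coef_scaleE !expand_coef /=.
case: eqP => [->|_]; last by rewrite mulr0.
rewrite coefD !coefZ coefXM coef_deriv ratrD_pchar0 // ratrM_pchar0 // ratr_nat_pchar0 //.
case: k => [|k] /=; first by rewrite !(mulr0, addr0).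
by rewrite mulrDl -[p`_k.+1 *+ _]mulr_natl mulrA.
Qed.

Lemma y_dy_expand w c p :
  xy K 0 1 * d_y (expand w c p) = expand w c ('X * p^`()).
Proof.
rewrite y_dy; apply/malgP => -[a k]; rewrite coef_scaleE !expand_coef /=.
case: ifP => _; last by rewrite mulr0.
by rewrite coefXM coef_deriv; case: k => [|k] /=; rewrite ?mul0r // mulr_natl.
Qed.

Lemma xy_bracket P Q :
  xy K 1 1 * bracket P Q =
  (xy K 1 0 * d_x P) * (xy K 0 1 * d_y Q) - (xy K 1 0 * d_x Q) * (xy K 0 1 * d_y P).
Proof.
have -> : xy K 1 1 = xy K 1 0 * xy K 0 1 by rewrite xyM addr0.
exact: mulrACAB.
Qed.

(** Multiplication by [x y] turns the derivatives into Euler operators. The two terms carrying the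
    factor [c] are both [c X^2 p' q'] and cancel. *)
Lemma bracket_expand w1 w2 c p q :
  xy K 1 1 * bracket (expand w1 c p) (expand w2 c q) =
  expand (w1 + w2) c
    ('X * ((ratr w1 : K) *: (p * q^`()) - (ratr w2 : K) *: (q * p^`()))).
Proof.
rewrite xy_bracket !x_dx_expand !y_dy_expand !expandM (addrC w2) -expandB; congr expand.
rewrite -!mul_polyC; ring.
Qed.

Lemma bracket_expand_eq w1 w2 c p q i : q != 0 ->
  bracket (expand w1 c p) (expand w2 c q) = expand w2 c q ^+ i ->
  w1 + w2 = w2 *+ i + 1 - c /\
  (ratr w1 : K) *: (p * q^`()) - (ratr w2 : K) *: (q * p^`()) = q ^+ i.
Proof.
move=> q0 E.
(* Since [x y = x^(1-c) (x^c y)], both sides become expansions in the same variable and can be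
   compared. *)
have XE : xy K 1 1 = expand (1 - c) c 'X.
  rewrite expand.unlock /horner_alg /= /horner_morph /= map_polyX hornerX xyM.
  by rewrite subrK.
have := congr1 ( *%R (xy K 1 1)) E.
rewrite bracket_expand {1}XE expandX expandM => /expand_inj [|-> /mulfI ->].
- by rewrite mulf_neq0 ?polyX_eq0 ?expf_neq0.
- by rewrite [LHS]addrC addrA.
- by rewrite polyX_eq0.
Qed.

End Puiseux.

(** * Irreducible factors and splitting extensions *)

Lemma irreducible_factor (F : fieldType) (p : {poly F}) :
  (1 < size p)%N -> exists2 q, q %| p & irreducible_poly q.
Proof.
have [n] := ubnP (size p); elim: n p => // n IHn p lepn p_gt1.
(* Irreducibility is settled by excluded middle; a reducible [p] has a proper divisor of smaller
   size, to which the induction applies. *)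
have [irr|Nirr] := classic (irreducible_poly p); first by exists p.
have [q [q_n1 qp qNp]] : exists q : {poly F}, [/\ size q != 1%N, q %| p & ~~ (q %= p)].
  apply: NNPP => H; apply: Nirr; split=> // q q1 qp.
  by apply/negPn/negP => qNp; apply: H; exists q.
have p0 : p != 0 by rewrite -size_poly_gt0 ltnW.
have q0 : q != 0 by apply: contraTneq qp => ->; rewrite dvd0p.
have q_gt1 : (1 < size q)%N by rewrite ltn_neqAle eq_sym q_n1 size_poly_gt0.
have ltqp : (size q < size p)%N.
  by rewrite ltn_neqAle dvdp_leq // andbT dvdp_size_eqp.
have [||s sq irr_s] := IHn q; [exact: leq_trans ltqp _ | by [] |].
by exists s => //; apply: dvdp_trans sq qp.
Qed.

(** Adjoin a root of an irreducible factor, divide by the linear factor and continue over the larger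
    field. *)
Lemma splitting_extension (F : fieldType) (p : {poly F}) : p != 0 ->
  exists (L : fieldExtType F) (rs : seq L),
    map_poly (in_alg L) p %= \prod_(a <- rs) ('X - a%:P).
Proof.
have [n] := ubnP (size p); elim: n F p => // n IHn F p lepn p0.
have [p_le1|p_gt1] := leqP (size p) 1.
  exists F^o, [::].
  by rewrite big_nil -size_poly_eq1 size_map_poly eqn_leq p_le1 size_poly_gt0.
have [r rp /irredp_FAdjoin [M _ [x rx _]]] := irreducible_factor p_gt1.
have /factor_theorem [q Dp] : root (map_poly (in_alg M) p) x.
  by rewrite -(divpK rp) rmorphM rootM rx orbT.
have szp : size p = size (q * ('X - x%:P)) by rewrite -Dp size_map_poly.
have q0 : q != 0.
  by move: p0; rewrite -size_poly_eq0 szp size_poly_eq0 mulf_eq0 => /norP[].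
have [|L [rs Dq]] := IHn M q _ q0.
  by move: lepn; rewrite szp size_mul ?polyXsubC_eq0 // size_XsubC addn2.
(* The tower is collapsed: [L], built over [M], is viewed over [F], and the root [x] of [M] is
   carried into [L]. *)
exists (baseFieldType L), (rcons rs (x%:A : L)).
have -> : map_poly (in_alg (baseFieldType L)) p =
          map_poly (in_alg L) (map_poly (in_alg M) p).
  rewrite -map_poly_comp; apply: eq_map_poly => a.
  by rewrite /= baseField_scaleE.
rewrite Dp rmorphM /= -cats1 big_cat big_seq1 /= rmorphB /= map_polyX map_polyC.
exact: eqp_mulr.
Qed.

(** * Orders of vanishing and degrees in the bracket equation *)

Section Multiplicity.
Variable F : fieldType.
Implicit Types (p q g r : {poly F}) (a : F).

Lemma mup_factor a q : q != 0 ->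
  exists2 q1, ~~ root q1 a & q = q1 * ('X - a%:P) ^+ mup a q.
Proof.
move=> q0; have [m [q1]] := multiplicity_XsubC q a; rewrite q0 /= => q1a Dq.
by exists q1 => //; rewrite [in mup a q]Dq mupMr // mup_XsubCX eqxx.
Qed.

Lemma mupX a q n : q != 0 -> mup a (q ^+ n) = (n * mup a q)%N.
Proof.
move=> q0; elim: n => [|n IHn]; first by rewrite mupNroot // expr0 root1.
by rewrite exprS mupM ?expf_neq0 // IHn mulSn.
Qed.

(** Dividing out the full power at one root lowers the degree by its multiplicity and leaves the
    multiplicities at the other points unchanged. *)
Lemma sum_mup_ltn_size (s : seq F) g :
  g != 0 -> uniq s -> (\sum_(a <- s) mup a g < size g)%N.
Proof.
elim: s g => [|a s IHs] g g0 /=; first by rewrite big_nil size_poly_gt0.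
case/andP=> a_s us; have [q qa Dg] := mup_factor a g0.
have q0 : q != 0 by apply: contraNneq qa => ->; rewrite root0.
rewrite big_cons {3}Dg size_mul ?expf_neq0 ?polyXsubC_eq0 // size_exp_XsubC addnS /=.
rewrite addnC -addSn leq_add2r; have -> // : (\sum_(b <- s) mup b g = \sum_(b <- s) mup b q)%N.
  rewrite big_seq [RHS]big_seq; apply: eq_bigr => b b_s.
  rewrite {1}Dg mupMl // -dvdp_XsubCl XsubC_dvd ?expf_neq0 ?polyXsubC_eq0 //.
  by rewrite mup_XsubCX (negPf (memPnC a_s b b_s)).
exact: IHs.
Qed.

(** The extra factor [X - a] keeps the exponent [n] in place of [n - 1], so that [n = 0] is not
    exceptional. *)
Lemma mul_XsubC_deriv a q1 n :
  ('X - a%:P) * (q1 * ('X - a%:P) ^+ n)^`() =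
  (('X - a%:P) * q1^`() + n%:R *: q1) * ('X - a%:P) ^+ n.
Proof.
rewrite derivM deriv_exp derivXsubC mul1r -mulr_natr -mul_polyC polyC_natr.
case: n => [|n]; first by rewrite !expr0 mulr0n; ring.
by rewrite /= exprS; ring.
Qed.

(** After multiplication by [X - a], the left side is [(X - a)^(m+n)] times a polynomial whose value
    at [a] is [(al m - be n) g1(a) r1(a)]. This is nonzero, so the order is exactly [m + n]; on the
    right it is [i m + 1]. *)
Lemma mup_bracket (al be : F) g r i a : g != 0 -> r != 0 ->
  al *: (g * r^`()) - be *: (r * g^`()) = r ^+ i ->
  al * (mup a r)%:R != be * (mup a g)%:R ->
  (mup a r + mup a g = i * mup a r + 1)%N.
Proof.
move=> g0 r0 E ne; have [r1 r1a Dr] := mup_factor a r0.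
have [g1 g1a Dg] := mup_factor a g0.
move: ne Dr Dg; set m := mup a r; set n := mup a g => ne Dr Dg.
have Er : ('X - a%:P) * r^`() = (('X - a%:P) * r1^`() + m%:R *: r1) * ('X - a%:P) ^+ m.
  by rewrite {1}Dr mul_XsubC_deriv.
have Eg : ('X - a%:P) * g^`() = (('X - a%:P) * g1^`() + n%:R *: g1) * ('X - a%:P) ^+ n.
  by rewrite {1}Dg mul_XsubC_deriv.
have /(congr1 (mup a)) : ('X - a%:P) * r ^+ i =
  ((al * m%:R - be * n%:R) *: (g1 * r1) +
   ('X - a%:P) * (al *: (g1 * r1^`()) - be *: (r1 * g1^`()))) * ('X - a%:P) ^+ (m + n).
  rewrite -E mulrBr -!scalerAr !(mulrCA ('X - _)).
  rewrite Er Eg {1}Dg {1}Dr exprD -!mul_polyC !rmorphB !rmorphM /=.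
  by rewrite !polyC_natr; ring.
rewrite mupM ?expf_neq0 ?polyXsubC_eq0 // mupX // -/m -['X - _]expr1 mup_XsubCX eqxx.
rewrite mupMr ?mup_XsubCX ?eqxx; first by rewrite addnC => ->.
rewrite rootE hornerD !hornerM hornerXsubC subrr mul0r addr0 hornerZ hornerM.
by rewrite !mulf_neq0 ?subr_eq0 -?rootE.
Qed.

Lemma coefM_top p q m n : (size p <= m.+1)%N -> (size q <= n.+1)%N ->
  (p * q)`_(m + n) = p`_m * q`_n.
Proof.
move=> sp sq; rewrite coefM.
have lt : (m < (m + n).+1)%N by rewrite ltnS leq_addr.
rewrite (bigD1 (Ordinal lt)) //= addKn big1 ?addr0 // => j nej.
have [ltj|gtj|ej] := ltngtP j m; last by rewrite -val_eqE /= ej eqxx in nej.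
  by rewrite (nth_default _ (leq_trans sq _)) ?mulr0 // ltn_subRL ltn_add2r.
by rewrite nth_default ?mul0r // (leq_trans sp).
Qed.

(** The same comparison at infinity: after multiplication by [X], the coefficient at [M + N] is
    [al M - be N] times both leading coefficients, so [M + N] is at most the degree of [X r^i]. *)
Lemma degree_bracket (al be : F) g r i : g != 0 -> r != 0 ->
  al *: (g * r^`()) - be *: (r * g^`()) = r ^+ i ->
  al * (size r).-1%:R != be * (size g).-1%:R ->
  ((size r).-1 + (size g).-1 <= i * (size r).-1 + 1)%N.
Proof.
move=> g0 r0 E; set M := (size r).-1; set N := (size g).-1 => ne.
have sr : size r = M.+1 by rewrite prednK // size_poly_gt0.
have sg : size g = N.+1 by rewrite prednK // size_poly_gt0.
have szX (q : {poly F}) k : size q = k.+1 -> (size ('X * q^`())%R <= k.+1)%N.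
  move=> sq; rewrite (leq_trans (size_polyMleq _ _)) // size_polyX add2n /= -sq.
  by apply: lt_size_deriv; rewrite -size_poly_gt0 sq.
have cX (q : {poly F}) k : ('X * q^`())`_k = k%:R * q`_k.
  by rewrite coefXM coef_deriv; case: k => [|k] /=; rewrite ?mul0r // mulr_natl.
have : ('X * r ^+ i)`_(M + N) != 0.
  rewrite -E mulrBr -!scalerAr !(mulrCA 'X) coefB !coefZ {1}(addnC M).
  rewrite !coefM_top ?szX ?sr ?sg // !cX.
  have -> : al * (g`_N * (M%:R * r`_M)) - be * (r`_M * (N%:R * g`_N)) =
      (al * M%:R - be * N%:R) * (g`_N * r`_M) by ring.
  rewrite !mulf_neq0 ?subr_eq0 //.
    by rewrite /N -lead_coefE lead_coef_eq0.
  by rewrite /M -lead_coefE lead_coef_eq0.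
apply: contraNT; rewrite -ltnNge => lt; apply/eqP/nth_default.
rewrite mulrC size_mulX ?expf_neq0 // (leq_trans _ lt) // addn1 ltnS mulnC -size_exp.
by rewrite prednK // size_poly_gt0 expf_neq0.
Qed.

End Multiplicity.

(** * Multiplicities of roots of sparse polynomials *)

Section Polynomial.
Variables (F : fieldType) (charF : [pchar F] =i pred0).

(** The derivative [e X^(e-1)] does not vanish at [a] in characteristic zero, so the root is
    simple. *)
Lemma mup_Xn_subC (a : F) e : (0 < e)%N -> a != 0 ->
  mup a ('X^e - (a ^+ e)%:P) = 1%N.
Proof.
move=> e0 a0; have p0 : 'X^e - (a ^+ e)%:P != 0.
  by rewrite -size_poly_eq0 size_XnsubC.
apply/eqP; rewrite eqn_leq mup_leq // -XsubC_dvd //.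
rewrite dvdp_XsubCl rootE !hornerE subrr eqxx andbT.
apply/negP => /dvdpP [q /(congr1 (fun p => p^`().[a]))].
rewrite derivB derivXn derivC subr0 hornerMn hornerXn derivM hornerD !hornerM.
rewrite deriv_exp derivXsubC mul1r hornerMn !horner_exp hornerXsubC subrr !expr0n.
rewrite mul0rn !mulr0 addr0 -mulr_natr => /eqP; rewrite mulf_eq0 expf_eq0 (negPf a0) andbF.
by rewrite natr_eq0_pchar0 // eqn0Ngt e0.
Qed.

(* With [r = X^k p(X^e)], a nonzero root [a] of [r] corresponds to the root [a^e] of [p],
   of the same multiplicity. *)
Lemma mup_sparse (r : {poly F}) k e (a : F) : r != 0 -> (0 < e)%N -> a != 0 ->
  (forall j, r`_j != 0 -> (k <= j)%N /\ (e %| j - k)%N) ->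
  (mup a r * e <= (size r).-1 - k)%N.
Proof.
move=> r0 e0 a0 supp_r.
pose p := \poly_(j < size r) r`_(k + j * e).
have Dr : r = 'X^k * (p \Po 'X^e).
  apply/polyP => j; rewrite coefXnM; case: ltnP => [ltjk|lekj].
    by apply: contraTeq ltjk => /supp_r []; rewrite leqNgt.
  rewrite coef_comp_poly_Xn //; case: ifP => [ej|Nej]; last first.
    by apply: contraFeq Nej => /supp_r [].
  rewrite coef_poly divnK // subnKC //; case: ltnP => // szr.
  by rewrite nth_default // (leq_trans szr) // (leq_trans (leq_div _ _)) // leq_subr.
have p0 : p != 0 by apply: contraNneq r0 => p0; rewrite Dr p0 comp_poly0 mulr0.
have [q qa Dp] := mup_factor (a ^+ e) p0; set m := mup _ p in Dp.
have Dc : p \Po 'X^e = (q \Po 'X^e) * ('X^e - (a ^+ e)%:P) ^+ m.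
  by rewrite Dp comp_polyM rmorphXn /= comp_polyB comp_polyX comp_polyC.
have -> : mup a r = m.
  rewrite Dr mupMr ?rootE ?hornerXn ?expf_neq0 // Dc.
  rewrite mupMr ?rootE ?horner_comp ?hornerXn -?rootE //.
  by rewrite mupX ?mup_Xn_subC ?muln1 // -size_poly_eq0 size_XnsubC.
(* It remains to combine [m <= deg p] with [e deg p = deg r - k]. *)
have ltm : (m < size p)%N by have := @sum_mup_ltn_size _ [:: a ^+ e] _ p0 isT; rewrite big_seq1.
have c0 : p \Po 'X^e != 0 by apply: contraNneq r0 => c0; rewrite Dr c0 mulr0.
have -> : ((size r).-1 - k = (size (p \Po 'X^e)).-1)%N.
  by rewrite {1}Dr mulrC size_mulXn //; lia.
rewrite size_comp_poly size_polyXn /= leq_mul2r -ltnS prednK ?ltm ?orbT //.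
by rewrite size_poly_gt0.
Qed.

End Polynomial.

(** * The dichotomy for the roots of [r] *)

(** If [a] is the only root, the coefficient of [r] below the leading one is
    [- lead_coef r * M * a]. As [M] is invertible in characteristic zero, [a] already lies in
    [K]. *)
Lemma linear_power_of_split (K : fieldType) (L : fieldExtType K) (r : {poly K}) (rs : seq L) :
  [pchar K] =i pred0 -> (1 < size r)%N ->
  map_poly (in_alg L) r %= \prod_(a <- rs) ('X - a%:P) ->
  {in rs &, forall a b, a = b} ->
  exists b, r = lead_coef r *: ('X - b%:P) ^+ (size r).-1.
Proof.
move=> charK r_gt1 Dr rs1; set M := (size r).-1.
have sr : size rs = M.
  by have := eqp_size Dr; rewrite size_map_poly size_prod_XsubC /M => ->.
have M0 : (0 < M)%N by rewrite -ltnS prednK // ltnW.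
have [a rsa] : exists a, rs = nseq M a.
  case: rs rs1 sr {Dr} => [|a rs] rs1 sr; first by rewrite -sr in M0.
  exists a; rewrite -sr; apply/all_pred1P/allP => b b_rs.
  by apply/eqP/rs1 => //; apply: mem_head.
have /eqpP [[c1 c2] /= /andP [c10 c20] E] := Dr.
pose c := c1^-1 * c2.
have {}E : map_poly (in_alg L) r = c *: \prod_(b <- rs) ('X - b%:P).
  by rewrite -scalerA -E scalerA mulVf // scale1r.
have charL : [pchar L] =i pred0 by move=> p; rewrite pchar_lalg charK.
have lM : lead_coef r != 0 by rewrite lead_coef_eq0 -size_poly_gt0 ltnW.
have lead_c : (lead_coef r)%:A = c.
  have := congr1 lead_coef E.
  by rewrite lead_coef_map lead_coefZ (monicP (monic_prod_XsubC _ _ _)) mulr1.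
have coef_c : (r`_M.-1)%:A = - ((lead_coef r)%:A * (M%:R * a)).
  have := congr1 (fun p : {poly L} => p`_M.-1) E.
  rewrite /= coef_map coefZ lead_c -{2}sr coefPn_prod_XsubC ?sr -?lt0n //.
  by rewrite rsa big_nseq iter_addr addr0 mulrN mulr_natl.
have M0K : M%:R != 0 :> K by rewrite natr_eq0_pchar0 // -lt0n.
pose b := - (r`_M.-1 / (lead_coef r * M%:R)).
have ab : a = in_alg L b.
  have n0 : in_alg L (lead_coef r * M%:R) != 0 by rewrite fmorph_eq0 mulf_neq0.
  apply: (mulIf n0); rewrite -rmorphM /b mulNr divfK ?mulf_neq0 // rmorphN /=.
  rewrite coef_c opprK -[(_ * _)%:A]/(in_alg L _) rmorphM rmorph_nat /=.
  by rewrite mulrCA (mulrC a).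
exists b; apply: (map_poly_inj (in_alg L)); rewrite E -lead_c rsa big_nseq iter_mulr_1.
by rewrite map_polyZ rmorphXn rmorphB /= map_polyX map_polyC ab.
Qed.

Lemma sum_count_undup (T : eqType) (s : seq T) :
  (\sum_(x <- undup s) count_mem x s = size s)%N.
Proof.
rewrite -[RHS](sum1_size s) -[RHS]big_undup_iterop_count /=.
apply: eq_bigr => x _; case: (count_mem x s) => // n; rewrite iteropS.
by elim: n => //= n <-.
Qed.

(** If no root satisfies [al m = be n], each root of multiplicity [m] in [r] has multiplicity
    [(i-1) m + 1] in [g]. Summing over the distinct roots bounds [deg g] below by [(i-1) M] plus
    their number, while [deg g <= (i-1) M + 1]. The assumption on degrees supplies this upper bound
    when the leading terms cancel. *)
Lemma bracket_dichotomy (K : fieldType) (al be : K) (g r : {poly K}) i :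
  [pchar K] =i pred0 -> g != 0 -> (1 < size r)%N -> (0 < i)%N ->
  al *: (g * r^`()) - be *: (r * g^`()) = r ^+ i ->
  (al * (size r).-1%:R = be * (size g).-1%:R ->
    ((size g).-1 <= i.-1 * (size r).-1 + 1)%N) ->
  (exists b, r = lead_coef r *: ('X - b%:P) ^+ (size r).-1) \/
  exists (L : fieldExtType K) (a : L),
    let m := mup a (map_poly (in_alg L) r) in
    let n := mup a (map_poly (in_alg L) g) in
    (0 < m)%N /\ al * m%:R = be * n%:R.
Proof.
move=> charK g0 r_gt1 i0 E degE; set M := (size r).-1.
have r0 : r != 0 by rewrite -size_poly_gt0 ltnW.
have [L [rs Dr]] := splitting_extension r0.
set rL := map_poly _ r in Dr; set gL := map_poly (in_alg L) g.
have rL0 : rL != 0 by rewrite map_poly_eq0.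
have gL0 : gL != 0 by rewrite map_poly_eq0.
have EL : (in_alg L al) *: (gL * rL^`()) - (in_alg L be) *: (rL * gL^`()) = rL ^+ i.
  by rewrite /gL /rL !deriv_map -!rmorphM -!map_polyZ -rmorphB E rmorphXn.
have [|good] := classic (exists a : L, (0 < mup a rL)%N /\
    al * (mup a rL)%:R = be * (mup a gL)%:R); first by case=> a [? ?]; right; exists L, a.
left; apply: (@linear_power_of_split K L r rs charK r_gt1 Dr) => a b a_rs b_rs.
have mupr c : mup c rL = count_mem c rs.
  rewrite -mu_prod_XsubC; move/eqpP: Dr => [[c1 c2] /= /andP [c10 c20] /(congr1 (mup c))].
  by rewrite -!mul_polyC !mupMr ?rootC.
have mupg c : c \in rs -> mup c gL = (i.-1 * count_mem c rs + 1)%N.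
  move=> c_rs; have m0 : (0 < mup c rL)%N by rewrite mupr -has_count has_pred1.
  have ne : (in_alg L al) * (mup c rL)%:R != (in_alg L be) * (mup c gL)%:R.
    rewrite -!(rmorph_nat (in_alg L)) -!rmorphM; apply/eqP => /fmorph_inj En.
    by apply: good; exists c.
  by have := mup_bracket gL0 rL0 EL ne; rewrite -mupr; case: (i) i0 => //= k _; lia.
have srs : size rs = M.
  by have := eqp_size Dr; rewrite size_map_poly size_prod_XsubC /M => ->.
have := sum_mup_ltn_size gL0 (undup_uniq rs).
rewrite big_seq (eq_bigr (fun c => (i.-1 * count_mem c rs + 1)%N)); last first.
  by move=> c; rewrite mem_undup => /mupg.
rewrite -big_seq big_split -big_distrr /= sum_count_undup sum1_size srs size_map_poly => lt.
have leN : ((size g).-1 <= i.-1 * M + 1)%N.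
  have [/degE //|ne] := eqVneq (al * M%:R) (be * (size g).-1%:R).
  by have := degree_bracket g0 r0 E ne; rewrite -/M; case: (i) i0 => //= k _; lia.
have : (size (undup rs) <= 1)%N.
  by move: lt leN; move: (size g) (size _) (_ * M)%N => x y z; lia.
rewrite -mem_undup in a_rs; rewrite -mem_undup in b_rs.
by case: (undup rs) a_rs b_rs => [|c [|]] //; rewrite !inE => /eqP -> /eqP ->.
Qed.

(** * Supports of expansions and their end points *)

Section Support.
Variable K : fieldType.
Implicit Types (P : puiseux K) (p : {poly K}) (w c : rat).

Lemma mem_supp_expand w c p k :
  p`_k != 0 -> (w + c * k%:R, k%:Z) \in supp (expand w c p).
Proof.
move=> pk; apply/mapP; exists (w + c * k%:R, k) => //.
by rewrite -mcoeff_neq0 expand_coef eqxx.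
Qed.

Lemma supp_expandP w c p x : x \in supp (expand w c p) ->
  exists2 k : nat, p`_k != 0 & x = (w + c * k%:R, k%:Z).
Proof.
case/mapP => -[a k]; rewrite -mcoeff_neq0 expand_coef /=.
by case: ifP => [/eqP -> pk ->|]; [exists k | rewrite eqxx].
Qed.

Lemma in_L_expand l w c p k : in_L l (expand w c p) -> p`_k != 0 ->
  exists A : int, (w + c * k%:R) * l%:R = A%:~R.
Proof.
move=> pL pk; apply/intrP; apply: (pL (w + c * k%:R, k)).
by rewrite -mcoeff_neq0 expand_coef eqxx.
Qed.

Lemma supp_eq0 P : (supp P == [::]) = (P == 0).
Proof.
apply/eqP/eqP => [s0|->]; last by rewrite /supp msupp0.
apply/malgP => m; rewrite mcoeff0; apply: mcoeff_outdom; apply/negP => mP.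
by have := map_f (fun m : rat * nat => (m.1, m.2%:Z)) mP; rewrite -/(supp P) s0.
Qed.

Lemma stP P : P != 0 -> st P \in supp P /\ {in supp P, forall x, (st P).2 <= x.2}.
Proof.
have tot : total (fun x y : rat * int => x.2 <= y.2) by move=> x y; apply: le_total.
have := sort_sorted tot (supp P); rewrite -supp_eq0.
have memP x : (x \in supp_by_y P) = (x \in supp P) by apply: mem_sort.
rewrite -/(supp_by_y P) /st -size_eq0 -(size_sort (fun x y : rat * int => x.2 <= y.2)).
rewrite -/(supp_by_y P); case: (supp_by_y P) memP => //= x s memP.
rewrite path_sortedE; last by move=> ? ? ?; apply: le_trans.
case/andP => /allP le_x _ _; split; first by rewrite -memP mem_head.
by move=> y; rewrite -memP inE => /predU1P [->|/le_x].
Qed.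

Lemma enP P : P != 0 -> en P \in supp P /\ {in supp P, forall x, x.2 <= (en P).2}.
Proof.
have tot : total (fun x y : rat * int => x.2 <= y.2) by move=> x y; apply: le_total.
have := sort_sorted tot (supp P); rewrite -supp_eq0.
have memP x : (x \in supp_by_y P) = (x \in supp P) by apply: mem_sort.
rewrite -/(supp_by_y P) /en -size_eq0 -(size_sort (fun x y : rat * int => x.2 <= y.2)).
rewrite -/(supp_by_y P); case/lastP: (supp_by_y P) memP => //= s x memP.
(* Reversing the list makes its last element the head of a list sorted for the opposite order. *)
rewrite last_rcons -rev_sorted rev_rcons /= path_sortedE; last first.
  by move=> y x' z /= le1 le2; apply: le_trans le2 le1.
case/andP => /allP le_x _ _; split; first by rewrite -memP mem_rcons mem_head.
by move=> y; rewrite -memP mem_rcons inE -mem_rev => /predU1P [->|/le_x].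
Qed.

Lemma expand_neq0 w c p : p != 0 -> expand w c p != 0.
Proof.
move=> p0; rewrite -supp_eq0; apply/negP => /eqP s0.
have := @mem_supp_expand w c p (size p).-1; rewrite s0 -lead_coefE lead_coef_eq0.
by move/(_ p0).
Qed.

Lemma st_expand w c p m : p`_m != 0 -> (forall j, p`_j != 0 -> (m <= j)%N) ->
  st (expand w c p) = (w + c * m%:R, m%:Z).
Proof.
move=> pm min_m; have p0 : p != 0 by apply: contraNneq pm => ->; rewrite coef0.
have [/supp_expandP [k pk ->] /(_ _ (mem_supp_expand w c pm)) /=] :=
  stP (expand_neq0 w c p0).
rewrite lez_nat => lekm; suff -> : k = m by [].
by apply/eqP; rewrite eqn_leq lekm min_m.
Qed.

Lemma en_expand w c p : p != 0 ->
  en (expand w c p) = (w + c * (size p).-1%:R, (size p).-1%:Z).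
Proof.
move=> p0; have pM : p`_(size p).-1 != 0 by rewrite -lead_coefE lead_coef_eq0.
have [/supp_expandP [k pk ->] /(_ _ (mem_supp_expand w c pM)) /=] :=
  enP (expand_neq0 w c p0).
rewrite lez_nat => leMk; suff -> : k = (size p).-1 by [].
apply/eqP; rewrite eqn_leq leMk andbT -ltnS prednK ?size_poly_gt0 //.
by rewrite ltnNge; apply: contraNN pk => /leq_sizeP ->.
Qed.

Lemma expand_monomial w c p m : p`_m != 0 -> (forall j, p`_j != 0 -> j = m) ->
  is_monomial (expand w c p).
Proof.
move=> pm p_m; have := mem_supp_expand w c pm.
rewrite /is_monomial; have : uniq (supp (expand w c p)).
  by rewrite map_inj_uniq ?fset_uniq // => -[a j] [b k] /= [-> ->].
have := @supp_expandP w c p; case: (supp _) => [|x [|y s]] //= H.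
have [_ /p_m -> ->] := H x (mem_head _ _).
have [|_ /p_m -> ->] := H y; first by rewrite !inE eqxx orbT.
by rewrite mem_head.
Qed.

End Support.

(** * Lattice points on a weighted line, and directions *)

(** Links the root 0 of [r] with the starting point of [R]: dividing by the full power of [X] leaves
    a nonzero constant term. *)
Lemma mup0P (F : fieldType) (p : {poly F}) : p != 0 ->
  p`_(mup 0 p) != 0 /\ forall j, p`_j != 0 -> (mup 0 p <= j)%N.
Proof.
move=> p0; have [q q0 Dp] := mup_factor 0 p0; move: Dp; set m := mup 0 p; rewrite subr0 => Dp.
split=> [|j]; rewrite Dp coefMXn ?ltnn ?subnn; first by rewrite -horner_coef0 -rootE.
by case: ltnP; rewrite ?eqxx.
Qed.

(** The points [(A/l, k)] of weight zero form a lattice of rank one with generator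
    [(A, k) = (- sigma l', rho')]: once the gcd is divided out, [rho'] is coprime to [sigma l'],
    hence divides [k]. *)
Lemma coprimez_lattice (rho sigma l : int) : coprimez rho sigma -> 0 < rho ->
  let rho' := (rho %/ gcdz rho l)%Z in let l' := (l %/ gcdz rho l)%Z in
  [/\ rho = rho' * gcdz rho l, l = l' * gcdz rho l, coprimez rho' (sigma * l') &
    forall A k, A * rho = - sigma * k * l ->
      exists q, k = rho' * q /\ A = - sigma * l' * q].
Proof.
move=> cop rho0 rho' l'; set d := gcdz rho l.
have d0 : d != 0 by rewrite gcdz_eq0 negb_and gt_eqF.
have Dr : rho = rho' * d by rewrite divzK ?dvdz_gcdl.
have Dl : l = l' * d by rewrite divzK ?dvdz_gcdr.
have copl : coprimez rho' l'.
  rewrite /coprimez -(inj_eq (mulIf d0)) mul1r.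
  by rewrite -[X in _ * X]ger0_norm // mulz_gcdl -?Dr -?Dl // /d.
have cops : coprimez rho' sigma.
  by move: cop; rewrite {1}Dr coprimezMl => /andP [].
have copm : coprimez rho' (sigma * l') by rewrite coprimezMr cops.
have rho'0 : rho' != 0 by apply: contraTneq rho0 => e; rewrite Dr e mul0r.
split=> // A k; rewrite Dr Dl => E.
have {}E : A * rho' = - (sigma * l') * k by apply: (mulIf d0); lia.
have : (rho' %| k)%Z.
  rewrite -(Gauss_dvdzr k copm); have -> : sigma * l' * k = - A * rho'.
    by rewrite mulNr E; ring.
  exact: dvdz_mull.
case/dvdzP => q Dk; exists q; split; first by rewrite Dk mulrC.
by apply: (mulIf rho'0); rewrite E Dk; ring.
Qed.

(** The assumption says that the vector has weight zero. A multiple [n (1,1)] has weight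
    [n (rho + sigma)], and here [n > 0] because the second coordinate is at least [theta]. *)
Lemma is_dir_opp (rho sigma : int) (x : rat) (m t theta : nat) :
  coprimez rho sigma -> rho + sigma < 0 -> (0 < theta)%N ->
  t%:R * val_pt rho sigma (x, m%:Z) = - (rho + sigma)%:~R * theta%:R ->
  is_dir ((x, m%:Z) *+ t + (1, 1) *+ theta) (- rho, - sigma).
Proof.
move=> cop rs0 th0 E.
have pairMn (a : rat) (b : int) n : (a, b) *+ n = (a *+ n, b *+ n).
  by elim: n => [|n IHn]; rewrite ?mulr0n // !mulrS IHn.
have val0 : val_pt (- rho) (- sigma) ((x, m%:Z) *+ t + (1, 1) *+ theta) = 0.
  have Ey : (m%:Z *+ t + 1 *+ theta)%:~R = m%:R * t%:R + theta%:R :> rat.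
    by rewrite -[m%:Z *+ t]mulr_natr !natz -PoszM -PoszD -pmulrn natrD natrM.
  move: E; rewrite !pairMn /val_pt /= Ey intrD !mulrNz -[x *+ t]mulr_natr => E; lra.
split=> //=.
- move=> n Dn; have n0 : 0 < n.
    by move/(congr1 snd): Dn => /= <-; rewrite pairMn pairMn /=; lia.
  move: val0; rewrite Dn /val_pt /= -!intrM -intrD => /eqP; rewrite intr_eq0.
  by nia.
- by rewrite coprimezN coprimeNz.
- by lia.
Qed.

(** * Assembly of the three cases *)

Theorem proposition3p12
    (K : fieldType) (charK : [pchar K] =i pred0)
    (l : nat) (l_gt0 : (0 < l)%N)
    (rho sigma : int) (cop : coprimez rho sigma)
    (rho_gt0 : 0 < rho) (rho_sigma : rho + sigma < 0)
    (R G : puiseux K) (RL : in_L l R) (GL : in_L l G)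
    (R_neq0 : R != 0)
    (R_hom : homogeneous rho sigma R) (G_hom : homogeneous rho sigma G)
    (R_nmon : ~~ is_monomial R)
    (i : nat) (i_gt0 : (0 < i)%N) (GR : bracket G R = R ^+ i)
    (u v : rat) (u_def : u = vdeg rho sigma R) (v_def : v = vdeg rho sigma G)
    (ell : rat) (ell_gt0 : 0 < ell)
    (ell_u : 0 < ell * u + rho%:~R + sigma%:~R)
    (r g : {poly K}) (R_r : R = z_expansion rho sigma u r)
    (G_g : G = z_expansion rho sigma v g)
    (ups1 nu1 ups2 nu2 : int)
    (st_R : st R = (ups2%:~R / l%:R, nu2))
    (en_R : en R - st R = (ups1%:~R / l%:R, nu1))
    (N1 : rat) (N1_def : N1 = nu1%:~R * (gcdz rho l)%:~R / rho%:~R)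
    (N2 : int) (N2_def : N2 = gcdz ups2 nu2) :
  [/\ N1 = (gcdz ups1 nu1)%:~R,
      [\/ linear_power_case l rho r,
          exists theta t' : nat,
            [/\ (0 < theta)%N /\ theta%:R <= N1,
                (0 < t')%N /\ t'%:R < ell * theta%:R,
                is_dir (st R *+ t' + (1, 1) *+ theta) (- rho, - sigma) &
                has_linear_factor_of_mult r theta]
        | exists theta t' : nat,
            [/\ (0 < theta)%N /\ (theta%:Z %| N2)%Z,
                (0 < t')%N /\ t'%:R < ell * theta%:R,
                is_dir (st R *+ t' + (1, 1) *+ theta) (- rho, - sigma) &
                0 < nu2]] &
      l = 1%N -> linear_power_case l rho r -> 0 < val_pt 1 (-2) (en R)].
Proof.
have rhoQ : 0 < rho%:~R :> rat by rewrite ltr0z.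
have rho0 : rho%:~R != 0 :> rat by rewrite gt_eqF.
have rsQ : rho%:~R + sigma%:~R < 0 :> rat by rewrite -intrD ltrz0.
have lQ : 0 < l%:R :> rat by rewrite ltr0n.
have l0 : l%:R != 0 :> rat by rewrite gt_eqF.
have u0 : 0 < u.
  rewrite ltNge; apply/negP => u_le0; have : ell * u <= 0 by rewrite pmulr_rle0.
  by lra.
rewrite !z_expansionE in R_r G_g.
set c := - sigma%:~R / rho%:~R in R_r G_g; set w := u / rho%:~R in R_r.
have rho_c : rho%:~R * c = - sigma%:~R by rewrite mulrC divfK.
have rho_w : rho%:~R * w = u by rewrite mulrC divfK.
have r0 : r != 0.
  by apply: contraNneq R_neq0 => r0; rewrite R_r r0 -(subrr 0) expandB subrr.
rewrite R_r in RL; rewrite G_g in GL; rewrite R_r G_g in GR.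
have [Ew E] := bracket_expand_eq charK r0 GR.
have Ev : v = (i%:R - 1) * u + rho%:~R + sigma%:~R.
  have rho_v : rho%:~R * (v / rho%:~R) = v by rewrite mulrC divfK.
  have /(congr1 ( *%R rho%:~R)) := Ew; rewrite -(mulr_natr w i).
  rewrite mulrDr rho_v rho_w mulrBr rho_c mulrDr mulr1 mulrA rho_w => H; lra.
have g0 : g != 0.
  apply: contraTneq (expf_neq0 i r0) => g0; rewrite -E g0 deriv0 mul0r mulr0.
  by rewrite !scaler0 subrr eqxx.
have [rm min_m] := mup0P r0; set m := mup 0 r in rm min_m.
set M := (size r).-1.
have rM : r`_M != 0 by rewrite -lead_coefE lead_coef_eq0.
have leM j : r`_j != 0 -> (j <= M)%N.
  by rewrite -ltnS prednK ?size_poly_gt0 // ltnNge; apply: contraNN => /leq_sizeP ->.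
(* [m] and [M] are the second coordinates of [st R] and [en R]; they differ because [R] is not a
   monomial. *)
have ltmM : (m < M)%N.
  rewrite ltn_neqAle min_m // andbT; apply: contraNneq R_nmon => mM.
  rewrite R_r; apply: expand_monomial rm _ => j rj; apply/eqP.
  by rewrite eqn_leq min_m // mM leM.
have r_gt1 : (1 < size r)%N by move: ltmM; rewrite /M; case: (size r) => [|[|k]].
move: st_R en_R; rewrite R_r (st_expand w c rm min_m) en_expand // -/M => st_R en_R.
have [Eups2 Enu2] : w + c * m%:R = ups2%:~R / l%:R /\ m%:Z = nu2 by case: st_R.
have [Eups1 Enu1] : c * (M%:R - m%:R) = ups1%:~R / l%:R /\ M%:Z - m%:Z = nu1.
  by case: en_R => <- <-; split => //; rewrite mulrBr; lra.
have [Drho Dl copm step] := coprimez_lattice l cop rho_gt0.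
set d := gcdz rho l in Drho Dl copm step N1_def.
set rho' := (rho %/ d)%Z in Drho copm step; set l' := (l %/ d)%Z in Dl copm step.
have d0 : 0 < d by rewrite lt0r gcdz_eq0 negb_and gt_eqF.
have rho'0 : 0 < rho' by rewrite -(pmulr_lgt0 _ d0) -Drho.
(* Lattice points on the line of weight [u] differ from [st R] by multiples of the generator. *)
have {}step A j : c * (j%:R - m%:R) * l%:R = A%:~R ->
    exists q, j%:Z - m%:Z = rho' * q /\ A = - sigma * l' * q.
  move=> EA; apply: step; apply: (@intr_inj rat).
  rewrite !intrM intrB mulrNz -!pmulrn -EA -rho_c; ring.
have ups2E : (w + c * m%:R) * l%:R = ups2%:~R by rewrite Eups2 divfK.
have supp_r j : r`_j != 0 -> (m <= j)%N /\ (`|rho'| %| j - m)%N.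
  move=> rj; split; first exact: min_m.
  have [A EA] := in_L_expand RL rj.
  have [|q [Eq _]] := step (A - ups2) j; first by rewrite intrB -EA -ups2E; ring.
  by apply/dvdnP; exists `|q|%N; rewrite mulnC -abszM -Eq subzn ?min_m.
have [q [Eq Aq]] : exists q, nu1 = rho' * q /\ ups1 = - sigma * l' * q.
  by rewrite -Enu1; apply: step; rewrite Eups1 divfK.
have q0 : 0 < q by rewrite -(pmulr_rgt0 _ rho'0) -Eq -Enu1 subr_gt0 ltz_nat.
have N1q : N1 = q%:~R.
  rewrite N1_def Eq [X in _ / X%:~R]Drho !intrM.
  have d0Q : d%:~R != 0 :> rat by rewrite intr_eq0 gt_eqF.
  have rho'0Q : rho'%:~R != 0 :> rat by rewrite intr_eq0 gt_eqF.
  by rewrite (mulrC rho'%:~R q%:~R) -(mulrA q%:~R) mulfK ?mulf_neq0.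
have gcd1 : (gcdz ups1 nu1)%:~R = q%:~R :> rat.
  have /eqP cop1 : coprimez rho' (- sigma * l') by rewrite mulNr coprimezN.
  by rewrite Aq Eq !(mulrC _ q) -mulz_gcdr gtz0_abs // gcdzC cop1 mulr1.
have uR0 : u != 0 by rewrite gt_eqF.
(* Equalities between scalars in [K] return to the rationals by injectivity of [ratr]. *)
have ratr_eq (k n : nat) : (ratr (v / rho%:~R) : K) * k%:R = ratr w * n%:R ->
    v * k%:R = u * n%:R.
  rewrite -!(ratr_nat_pchar0 charK) -!ratrM_pchar0 // => /(ratr_inj_pchar0 charK).
  rewrite mulrAC [w * _]mulrAC; apply: mulIf; exact: invr_neq0.
have iE : i%:R - 1 = i.-1%:R :> rat by rewrite -[i in LHS]prednK // mulrSr addrK.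
(* If the leading terms cancel, then [u N = v M = (i-1) u M + (rho + sigma) M <= (i-1) u M], with
   [N] the degree of [g]. *)
have degE : (ratr (v / rho%:~R) : K) * (size r).-1%:R = ratr w * (size g).-1%:R ->
    ((size g).-1 <= i.-1 * (size r).-1 + 1)%N.
  move/ratr_eq; rewrite Ev iE -/M => EvM.
  rewrite -(ler_nat rat) natrD natrM -(ler_pM2l u0) -EvM.
  have : (rho%:~R + sigma%:~R) * M%:R <= 0 :> rat by rewrite mulr_le0_ge0 ?ler0n // ltW.
  by lra.
have order_eq (k n : nat) : (0 < k)%N ->
    (ratr (v / rho%:~R) : K) * k%:R = ratr w * n%:R ->
    [/\ v * k%:R = u * n%:R, (n < i.-1 * k)%N &
        (i.-1 * k - n)%:R * u = - (rho + sigma)%:~R * k%:R].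
  move=> k0 /ratr_eq Evk; have Et : (i.-1%:R * k%:R - n%:R) * u = - (rho + sigma)%:~R * k%:R.
    by move: Evk; rewrite Ev iE intrD; lra.
  have ltn : (n < i.-1 * k)%N.
    rewrite -(ltr_nat rat) natrM -subr_gt0 -(pmulr_lgt0 _ u0) Et.
    by rewrite mulr_gt0 ?ltr0n // intrD oppr_gt0.
  by split=> //; rewrite natrB ?natrM // ltnW.
have valE : val_pt rho sigma (w + c * m%:R, m%:Z) = u.
  by rewrite /val_pt /= mulrDr rho_w mulrA rho_c -pmulrn; lra.
(* This is where [ell] enters: [- (rho + sigma) < ell u], and [u] is cancelled. *)
have lt_ell (k t : nat) : (0 < k)%N -> t%:R * u = - (rho + sigma)%:~R * k%:R ->
    t%:R < ell * k%:R.
  move=> k0 Et; rewrite -(ltr_pM2r u0) Et intrD mulrAC ltr_pM2r ?ltr0n //.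
  by lra.
split; first by rewrite N1q gcd1.
  have [[b Db]|] := bracket_dichotomy charK g0 r_gt1 i_gt0 E degE.
    apply: Or31.
    have lc0 : lead_coef r != 0 by rewrite lead_coef_eq0.
    have mupb a : mup a r = (if b == a then M else 0)%N.
      by rewrite Db -mul_polyC mupMr ?rootC // mup_XsubCX.
    have b0 : b != 0.
      by apply: contraTneq ltmM => b0; rewrite /m mupb b0 eqxx ltnn.
    have e0 : (0 < `|rho'|)%N by rewrite absz_gt0 gt_eqF.
    (* The single root [b] is nonzero, so sparsity gives [M rho' <= M - m]. Hence [rho' = 1], and
       [rho] is its gcd with [l]. *)
    have := mup_sparse charK r0 e0 b0 supp_r; rewrite mupb eqxx -/M => leMe.
    have e1 : `|rho'|%N = 1%N.
      apply/eqP; rewrite eqn_leq e0 andbT -(leq_pmul2l (leq_ltn_trans (leq0n m) ltmM)).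
      by rewrite muln1 (leq_trans leMe) // leq_subr.
    split; first by rewrite Drho -[rho']gtz0_abs // e1 mul1r dvdz_gcdr.
    exists (lead_coef r), ('X - b%:P), M; split; rewrite ?size_XsubC //.
      by rewrite -subr_eq0 addrC addKr oppr_eq0 polyC_eq0.
    exact: leq_ltn_trans ltmM.
  case=> L [a]; set k := mup a _; set n := mup a _; case=> k0 /(order_eq k n k0) [Evk ltn Et].
  set t := (i.-1 * k - n)%N in Et; have t0 : (0 < t)%N by rewrite subn_gt0.
  have rL0 : map_poly (in_alg L) r != 0 by rewrite map_poly_eq0.
  have gL0 : map_poly (in_alg L) g != 0 by rewrite map_poly_eq0.
  have coef_rL j : ((map_poly (in_alg L) r)`_j != 0) = (r`_j != 0).
    by rewrite coef_map fmorph_eq0.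
  have [a0|a0] := eqVneq a 0; last first.
    (* Sparsity gives [k rho' <= M - m = nu1 = rho' q], that is [k <= N1]. *)
    apply: Or32; exists k, t; split.
    - split=> //; rewrite N1q pmulrn ler_int.
      have e0 : (0 < `|rho'|)%N by rewrite absz_gt0 gt_eqF.
      have charL : [pchar L] =i pred0 by move=> p; rewrite pchar_lalg charK.
      have := @mup_sparse L charL _ m _ a rL0 e0 a0.
      rewrite size_map_poly -/M -/k => /(_ _) lek.
      have {}lek : (k * `|rho'| <= M - m)%N.
        by apply: lek => j; rewrite coef_rL; apply: supp_r.
      rewrite -(ler_pM2l rho'0) -Eq -Enu1 subzn ?(ltnW ltmM) //.
      by rewrite -[X in X * _ <= _]gtz0_abs // -PoszM lez_nat mulnC.
    - by split=> //; apply: lt_ell.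
    - by apply: is_dir_opp => //; rewrite valE.
    - by exists L, a.
  apply: Or33.
  have km : k = m.
    have Ek : mup 0 (map_poly (in_alg L) r) = k by rewrite /k a0.
    have [rk min_k] := mup0P rL0; rewrite Ek coef_rL in rk min_k.
    apply/anti_leq/andP; split; last exact: min_m.
    by apply: min_k; rewrite coef_rL; exact: rm.
  have gn : g`_n != 0.
    by have [] := mup0P gL0; rewrite -[in mup _ _]a0 -/n coef_map fmorph_eq0.
  have [B EB] := in_L_expand GL gn.
  (* The lowest points [(B/l, n)] of [G] and [(ups2/l, m)] of [R] are parallel, by [v m = u n]. *)
  have EBm : B * m%:Z = n%:Z * ups2.
    apply: (@intr_inj rat); rewrite !intrM -!pmulrn -EB -ups2E.
    have -> : (v / rho%:~R + c * n%:R) * l%:R * m%:R =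
        (v * m%:R / rho%:~R + c * n%:R * m%:R) * l%:R by ring.
    by rewrite -km Evk /w; ring.
  set y := gcdn m t.
  have y0 : (0 < y)%N by rewrite gcdn_gt0 t0 orbT.
  have Dm : m = (m %/ y * y)%N by rewrite divnK // dvdn_gcdl.
  have Dt : t = (t %/ y * y)%N by rewrite divnK // dvdn_gcdr.
  have m0 : (0 < m)%N by rewrite -km.
  have theta0 : (0 < m %/ y)%N by rewrite divn_gt0 // dvdn_leq // dvdn_gcdl.
  have t'0 : (0 < t %/ y)%N by rewrite divn_gt0 // dvdn_leq // dvdn_gcdr.
  have yQ : y%:R != 0 :> rat by rewrite pnatr_eq0 -lt0n.
  have Et' : (t %/ y)%:R * u = - (rho + sigma)%:~R * (m %/ y)%:R.
    by apply: (mulIf yQ); rewrite mulrAC -natrM -Dt Et -mulrA -natrM -Dm km.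
  have cop' : coprimez (m %/ y)%N (t %/ y)%N.
    rewrite coprimezE /coprime -(eqn_pmul2r y0) mul1n /= muln_gcdl -Dm -Dt.
    exact: eqxx.
  exists (m %/ y)%N, (t %/ y)%N; split.
  - split=> //; rewrite N2_def dvdz_gcd -Enu2 -[X in _ && (_ %| X)%Z]/(m%:Z).
    apply/andP; split; last first.
      by rewrite dvdzE; apply/dvdnP; exists y; rewrite /= mulnC -Dm.
    rewrite -(Gauss_dvdzr _ cop'); apply/dvdzP.
    (* From [B m = n ups2] one gets [t ups2 = ((i-1) ups2 - B) m]. Dividing by [y] shows that
       [theta = m / y] divides [t' ups2], and it is coprime to [t' = t / y]. *)
    exists (i.-1%:Z * ups2 - B).
    have y0Z : y%:Z != 0 by rewrite -lt0n.
    apply: (mulIf y0Z).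
    rewrite mulrAC -PoszM -Dt -[RHS]mulrA -PoszM -Dm mulrBl EBm /t km.
    by rewrite -subzn ?PoszM; [ring | rewrite -km ltnW].
  - by split=> //; apply: lt_ell.
  - by apply: is_dir_opp => //; rewrite valE.
  - by rewrite -Enu2.
move=> l1 [rho_l _].
have rho1 : rho = 1.
  by move: rho_l; rewrite l1 dvdz1 => /eqP; rewrite -{2}(gtz0_abs rho_gt0) => ->.
have s2 : sigma <= - 2 by move: rho_sigma; rewrite rho1; move: (sigma) => s; clear; lia.
rewrite /val_pt /= /w /c rho1 !divr1 mul1r -pmulrn.
(* Here [en R = (u - sigma M, M)], so its value is [u - (2 + sigma) M], which is at least
   [u > 0]. *)
have : (2 + sigma%:~R) * M%:R <= 0 :> rat.
  by rewrite mulr_le0_ge0 ?ler0n //; have : sigma%:~R <= (- 2)%:~R :> rat; [rewrite ler_int | lra].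
by move=> ?; lra.
Qed.
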